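(* Let $1\le n<\omega$ and $d\in\omega$, let $X_0,\ldots,X_{n-1}$ be infinite sets and let $X=\prod_{i<n}X_i$. (1) Let $\mathcal{C}$ be a class of subsets of $X$ with $\mathrm{VC}_n(\mathcal{C})\leq d$. Then for every natural number $m\geq d$, $$\pi_{\mathcal{C},n}(m)\leq \sum_{i<z}\binom{m^n}{i},\qquad\text{where } z=z_n(m,d+1).$$ (2) In particular, if $\mathrm{VC}_n(\mathcal{C})\leq d$, then for $m\gg n,d$ (that is, for all $m$ sufficiently large with respect to $n$ and $d$), $$\pi_{\mathcal{C},n}(m)\leq 2^{c\,m^{n-\varepsilon}\log_2 m}\leq 2^{m^{n-\varepsilon'}},$$ where $c=n^{n+1-\varepsilon}$, $\varepsilon=\dfrac{1}{(d+1)^{n-1}}$ and $\varepsilon'=\varepsilon'(n,d)>0$ is small enough. (3) There is a class $\mathcal{C}\subseteq\mathcal{P}(X)$ with $\mathrm{VC}_n(\mathcal{C})=d$ such that for every natural number $m$, $\pi_{\mathcal{C},n}(m)\geq 2^{z-1}$, where $z=z_n(m,d+1)$.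
   Context: For $\mathcal{C}\subseteq\mathcal{P}(X)$ and $A\subseteq X$ put $\mathcal{C}\cap A=\{C\cap A: C\in\mathcal{C}\}$. The set $A$ is shattered by $\mathcal{C}$ if $\mathcal{C}\cap A=\mathcal{P}(A)$. A subset $A\subseteq X=\prod_{i<n}X_i$ is a box of size $m$ if $A=\prod_{i<n}A_i$ with $A_i\subseteq X_i$ and $|A_i|=m$ for each $i<n$. The $\mathrm{VC}_n$-dimension of $\mathcal{C}$ is $\mathrm{VC}_n(\mathcal{C})=\sup\{\mathrm{size}(A): A\subseteq X\text{ is a box shattered by }\mathcal{C}\}$, and the corresponding shatter function is $\pi_{\mathcal{C},n}(m)=\max\{|\mathcal{C}\cap A|: A\subseteq X\text{ is a box of size }m\}$. An $n$-partite $n$-uniform hypergraph has its vertex set partitioned into $n$ parts, and each edge consists of exactly one vertex from each part. $G^{(n)}(m)$ denotes any $n$-partite $n$-uniform hypergraph all of whose parts have exactly $m$ vertices, and $K^{(n)}(d)$ denotes the complete one with all parts of size $d$. The Zarankiewicz number $z_n(m,d)$ is the minimum natural number $z$ such that every $G^{(n)}(m)$ having at least $z$ edges contains $K^{(n)}(d)$ as a subgraph.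
   Formalization: In (2) the first inequality is asserted only when n ≥ 2 or d = 0: for n = 1, d ≥ 1 it would say π(m) ≤ m, which fails for initial segments of an infinite sequence (VC_1 = 1, π(m) ≥ m+1); the second inequality and the bound π(m) ≤ 2^{m^{n-ε'}} are kept for all n, d. *)

(* Defs.v *)
From HB Require Import structures.
From mathcomp Require Import all_boot all_order all_algebra.
From mathcomp Require Import all_classical all_reals ereal exp.

Set Implicit Arguments.
Unset Strict Implicit.
Unset Printing Implicit Defensive.

Import Order.TTheory GRing.Theory Num.Theory.

Local Open Scope classical_set_scope.
Local Open Scope card_scope.

(* A point of the product of the X i (i < n) is a dependent function
   x : forall i, X i. *)
Section VCn.
Context {n : nat} {X : 'I_n -> Type}.
Implicit Types (C : set (set (forall i, X i))) (A : set (forall i, X i)).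

Definition is_box (m : nat) A : Prop :=
  exists B : forall i, set (X i),
    (forall i, B i #= `I_m) /\ A = [set x | forall i, B i (x i)].

Definition trace C A : set (set (forall i, X i)) := [set S `&` A | S in C].

Definition shatters C A : Prop := trace C A = [set S | S `<=` A].

(* The VC_n-dimension may be infinite, hence takes values in \bar R.  It is
   -oo for the empty class, which shatters no box at all. *)
Definition VCdim (R : realType) C : \bar R :=
  ereal_sup [set m%:R%:E | m in [set m | exists2 A, is_box m A & shatters C A]].

(* The supremum is a maximum: the set is bounded by 2 ^ (m ^ n), and it is
   nonempty as soon as every X i has a subset of size m. *)
Definition shatter_fun C (m : nat) : nat :=
  supremum 0%N [set k : nat | exists2 A, is_box m A & trace C A #= `I_k].

End VCn.

Section Zarankiewicz.
Local Open Scope nat_scope.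

(* Vertices are pairs (i, a): the i-th part is {i} x 'I_m. *)
Definition vertex (n m : nat) : finType := ('I_n * 'I_m)%type.

(* A hypergraph on V is given by its set of edges. *)
Definition hypergraph (V : finType) := {set {set V}}.

Definition part (n m : nat) (i : 'I_n) : {set vertex n m} :=
  [set v | v.1 == i]%SET.

Definition transversal (n m : nat) (e : {set vertex n m}) : bool :=
  [forall i : 'I_n, #|e :&: part m i| == 1].

Definition partite_uniform (n m : nat) (G : hypergraph (vertex n m)) : bool :=
  [forall e in G, transversal e].

Definition complete_partite (n d : nat) : hypergraph (vertex n d) :=
  [set e | transversal e]%SET.

Definition contains_hg (V W : finType) (G : hypergraph V) (H : hypergraph W) :
    bool :=
  [exists f : {ffun W -> V},
    injectiveb f && [forall e in H, f @: (e : {set W})%SET \in G]].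

Definition zarankiewicz_bound (n m d z : nat) : bool :=
  [forall G : hypergraph (vertex n m),
    partite_uniform G && (z <= #|G|) ==>
    contains_hg G (complete_partite n d)].

Lemma zarankiewicz_bound_ex (n m d : nat) :
  exists z, zarankiewicz_bound n m d z.
Proof.
exists (#|{set vertex n m}|.+1); apply/forallP => G; apply/implyP => /andP[_].
by rewrite ltnNge max_card.
Qed.

Definition zarankiewicz (n m d : nat) : nat :=
  ex_minn (zarankiewicz_bound_ex n m d).

End Zarankiewicz.

Definition log2 {R : realType} (x : R) : R := (ln x / ln 2)%R.

(* Main.v *)
Require Import Defs.
From mathcomp Require Import all_boot all_order all_algebra.
From mathcomp Require Import all_classical all_reals ereal exp.
From mathcomp Require Import zify ring lra.

(**
   Points of a box of size m are coded by finite functions from 'I_n to 'I_m,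
   and a transversal edge of a hypergraph with n parts of size m is the graph of
   such a function.  A copy of the complete hypergraph with parts of size l may
   permute the parts, but it always maps parts to parts; hence the Zarankiewicz
   number is the least z such that every set of z points of the m-grid contains
   a grid of side l ([zarankiewicz_box], [zarankiewicz_box_free]).

   Upper bound.  By Pajor's form of the Sauer-Shelah lemma, a finite family has
   at most as many members as it shatters sets ([leq_card_shattered_sets]).  If
   a class has VC_n-dimension at most d, then no set of z points of a box, with
   z the Zarankiewicz number for side d + 1, is shattered: such a set would
   contain a box of size d + 1, which would be shattered as well.  So the traces
   on the box are at most as many as the sets of fewer than z points.

   Asymptotics.  A set of points of the m-grid in dimension n >= 2 without a box
   of side l has at most 2 * m ^ (n - 1 / l ^ (n - 1)) elements
   ([box_free_le2]).  This is the argument of Kovari, Sos, Turan and Erdos, by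
   induction on the dimension: double counting over l-tuples of values of the
   first coordinate, and convexity, give an l-tuple of distinct values with a
   large common link, and a box in this link extends to a box in the set.  The
   sum of binomial coefficients 'C(m ^ n, i) over i < z is at most m ^ (n * z)
   when m >= 2, which gives the first exponential bound, and a logarithm is
   eventually below any power, which gives the second.  In dimension 1 the
   Zarankiewicz number is at most d + 1, so the shatter function is polynomial
   and the last bound persists, although the intermediate one is too small when
   d >= 1.

   Sharpness.  The class of all sets containing no box of size d + 1 is closed
   under subsets.  It shatters every box of size d, none of larger size, and in
   a box of size m it has all subsets of an extremal set of z - 1 points among
   its traces.
*)

Set Implicit Arguments.
Unset Strict Implicit.
Unset Printing Implicit Defensive.

Import Order.TTheory GRing.Theory Num.Theory.

(** * Families of finite sets and the sets that they shatter *)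

Section Pajor.
Import fintype boot.finset.
Variable T : finType.
Implicit Types (F : {set {set T}}) (S U E : {set T}).

Definition shattered_sets F : {set {set T}} :=
  [set S | powerset S \subset [set S :&: E | E in F]]%SET.

Lemma shattered_setsP F S :
  reflect (forall U, U \subset S -> exists2 E, E \in F & U = S :&: E)%SET
          (S \in shattered_sets F).
Proof.
rewrite inE; apply: (iffP subsetP) => [h U US | h U].
  by apply/imsetP/h; rewrite powersetE.
by rewrite powersetE => /h [E EF ->]; apply: imset_f.
Qed.

(** Pajor's inequality.  If some x lies in some but not all members of F, split
    F into the members avoiding x and the members containing x.  Sets shattered
    by either half avoid x and are shattered by F; a set S shattered by both
    halves is shattered by F together with x |: S.  So the counts of shattered
    sets of the two halves add up to at most that of F. *)
Lemma leq_card_shattered_sets F : (#|F| <= #|shattered_sets F|)%N.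
Proof.
have [k] := ubnP #|F|; elim: k F => // k IHk F; rewrite ltnS => Fk.
have [[S0 [S1 [S0F S1F S01]]] | Fsub] :
  (exists S0 S1, [/\ S0 \in F, S1 \in F & ~~ (S1 \subset S0)]) \/
  (forall S0 S1, S0 \in F -> S1 \in F -> S1 \subset S0).
- have [/existsP[S0 /existsP[S1 /and3P[]]] | /existsPn H] :=
    boolP [exists S0, exists S1, [&& S0 \in F, S1 \in F & ~~ (S1 \subset S0)]].
    by left; exists S0, S1.
  right=> S0 S1 S0F S1F; have /existsPn/(_ S1) := H S0.
  by rewrite S0F S1F /= negbK.
- have [x xS1 xS0] := subsetPn S01.
  pose F0 := [set S in F | x \notin S]%SET.
  pose F1 := [set S in F | x \in S]%SET.
  have F01 : F0 :|: F1 = F.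
    by apply/setP=> S; rewrite !inE; case: (S \in F) => //=; case: (x \in S).
  have dF : [disjoint F0 & F1].
    rewrite -setI_eq0; apply/eqP/setP=> S; rewrite !inE.
    by case: (x \in S); rewrite !(andbF, andFb).
  have cF : (#|F0| + #|F1| = #|F|)%N.
    by rewrite -[in RHS]F01 cardsU
      (eqP (_ : F0 :&: F1 == set0)%SET) ?setI_eq0 // cards0 subn0.
  have F0gt : (0 < #|F0|)%N by apply/card_gt0P; exists S0; rewrite inE S0F.
  have F1gt : (0 < #|F1|)%N by apply/card_gt0P; exists S1; rewrite inE S1F.
  have le0 : (#|F0| <= #|shattered_sets F0|)%N.
    by apply/IHk/(leq_trans _ Fk); rewrite -cF -[X in (X < _)%N]addn0 ltn_add2l.
  have le1 : (#|F1| <= #|shattered_sets F1|)%N.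
    by apply/IHk/(leq_trans _ Fk); rewrite -cF -[X in (X < _)%N]add0n ltn_add2r.
  have x0 S : S \in shattered_sets F0 -> x \notin S.
    move=> /shattered_setsP/(_ S (subxx _)) [E]; rewrite inE => /andP[_ xE] ->.
    by rewrite inE (negbTE xE) andbF.
  have x1 S : S \in shattered_sets F1 -> x \notin S.
    move=> /shattered_setsP/(_ set0 (sub0set _)) [E].
    rewrite inE => /andP[_ xE] /setP/(_ x).
    by rewrite !inE xE andbT => <-.
  pose J := [set x |: S | S in shattered_sets F0 :&: shattered_sets F1]%SET.
  have cJ : #|J| = #|shattered_sets F0 :&: shattered_sets F1|.
    apply: card_in_imset => S S'.
    rewrite !in_setI => /andP[/x0 xS _] /andP[/x0 xS' _].
    by move=> /(congr1 (fun A => A :\ x)%SET); rewrite !setU1K.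
  have JF : J \subset shattered_sets F.
    apply/subsetP=> _ /imsetP[S /setIP[h0 h1] ->].
    apply/shattered_setsP => U US.
    have US' : U :\ x \subset S by rewrite subDset.
    have [xU|xU] := boolP (x \in U).
      have /shattered_setsP/(_ _ US') [E EF1 UE] := h1.
      have:= EF1; rewrite inE => /andP[EF xE].
      exists E => //; rewrite -(setD1K xU) UE; apply/setP=> y.
      by rewrite !inE; case: eqP => [->|]; rewrite ?xE.
    have /shattered_setsP/(_ _ US') [E EF0 UE] := h0.
    have:= EF0; rewrite inE => /andP[EF xE].
    exists E => //; apply/setP=> y; move/setP/(_ y): UE; rewrite !inE.
    by case: eqP => [->|] //=; rewrite (negbTE xU) (negbTE xE).
  have KF : shattered_sets F0 :|: shattered_sets F1 \subset shattered_sets F.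
    have mono (F' F'' : {set {set T}}) :
        F' \subset F'' -> shattered_sets F' \subset shattered_sets F''.
      move=> sub; apply/subsetP=> S /shattered_setsP h; apply/shattered_setsP.
      by move=> U /h [E /(subsetP sub) EF ->]; exists E.
    by rewrite subUset !mono // -F01 ?subsetUl ?subsetUr.
  have dJ : [disjoint J & shattered_sets F0 :|: shattered_sets F1].
    rewrite disjoint_subset; apply/subsetP=> _ /imsetP[S _ ->].
    rewrite inE; apply/negP => /setUP[/x0|/x1]; by rewrite setU11.
  rewrite -cF; apply: leq_trans (leq_add le0 le1) _.
  rewrite -cardsUI -cJ addnC.
  have <- : #|J :|: (shattered_sets F0 :|: shattered_sets F1)| =
            (#|J| + #|shattered_sets F0 :|: shattered_sets F1|)%N.
    by apply/eqP; rewrite (leq_card_setU _ _).2.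
  by apply: subset_leq_card; rewrite subUset JF KF.
- have [->|[S SF]] := set_0Vmem F; first by rewrite cards0.
  have -> : F = [set S]%SET.
    apply/setP=> S'; rewrite inE; apply/idP/eqP => [S'F|->] //.
    by apply/eqP; rewrite eqEsubset !Fsub.
  rewrite cards1; apply/card_gt0P; exists set0; apply/shattered_setsP => U.
  by rewrite subset0 => /eqP->; exists S; rewrite ?inE ?set0I.
Qed.

Lemma card_small_sets (z : nat) :
  (#|[set S : {set T} | #|S| < z]%SET| = \sum_(i < z) 'C(#|T|, i))%N.
Proof.
rewrite -sum1_card.
(* The shift z.-1.+1 only makes the type of sizes inhabited; for z = 0 the sum
   has no term on either side. *)
rewrite (partition_big (fun S : {set T} => inord #|S| : 'I_z.-1.+1) predT) //=.
case: z => [|z].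
  by rewrite big_ord0 big1 // => i _; rewrite big_pred0 // => S; rewrite inE ltn0.
apply: eq_bigr => i _; rewrite -card_draws -sum1_card; apply: eq_bigl => S.
rewrite !inE; apply/andP/eqP => [[Sz /eqP <-]|Si]; first by rewrite inordK.
by rewrite Si ltn_ord; split=> //; rewrite inord_val.
Qed.

Lemma sauer_shelah F (z : nat) :
  (forall S, S \in shattered_sets F -> #|S| < z)%N ->
  (#|F| <= \sum_(i < z) 'C(#|T|, i))%N.
Proof.
move=> h; rewrite -card_small_sets.
apply: leq_trans (leq_card_shattered_sets F) _.
by apply: subset_leq_card; apply/subsetP=> S /h; rewrite inE.
Qed.

End Pajor.

(** * Point sets without a large grid *)

Section GridBoxes.
Import fintype boot.finset.
Local Open Scope nat_scope.

(** T contains the product of the images of the g i, a grid of side l. *)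
Definition has_box (n m l : nat) (T : {set {ffun 'I_n -> 'I_m}}) : Prop :=
  exists g : 'I_n -> 'I_l -> 'I_m, (forall i, injective (g i)) /\
    forall y : {ffun 'I_n -> 'I_l}, [ffun i => g i (y i)] \in T.

(** Each of the 'C(l, 2) pairs of positions is responsible for at most
    m ^ l.-1 non-injective l-tuples; the lemma is this union bound in numerical
    form. *)
Lemma ffact_lower (m l : nat) : m ^ l <= m ^_ l + 'C(l, 2) * m ^ l.-1.
Proof.
elim: l => [|l IHl] //.
have ffl : m ^_ l <= m ^ l.
  by elim: l {IHl} => // l IHl; rewrite ffactnSr expnSr leq_mul // leq_subr.
have e : 'C(l, 2) * m ^ l.-1 * m = 'C(l, 2) * m ^ l.
  by case: l {IHl ffl} => // l; rewrite -mulnA -expnSr.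
have := leq_mul IHl (leqnn m); rewrite -expnSr mulnDl e => /leq_trans; apply.
have step : m ^_ l * m <= m ^_ l * (m - l) + l * m ^ l.
  have [lm|/ltnW lm] := leqP l m.
    by rewrite -{2}(subnK lm) mulnDr leq_add2l mulnC leq_mul2l ffl orbT.
  by apply: (leq_trans _ (leq_addl _ _)); rewrite mulnC leq_mul.
by rewrite /= ffactnSr binS bin1 mulnDl; lia.
Qed.

Lemma card_noninjective_ffun (m l : nat) :
  #|[set L : {ffun 'I_l -> 'I_m} | ~~ injectiveb L]| <= 'C(l, 2) * m ^ l.-1.
Proof.
rewrite -(leq_add2l (m ^_ l)); apply: leq_trans (ffact_lower m l).
have <- : #|[set L : {ffun 'I_l -> 'I_m} | injectiveb L]| = m ^_ l.
  by rewrite card_inj_ffuns !card_ord.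
have <- : #|{ffun 'I_l -> 'I_m}| = m ^ l by rewrite card_ffun !card_ord.
rewrite -cardsUI (_ : _ :&: _ = set0) ?cards0 ?addn0 ?max_card //.
by apply/setP => L; rewrite !inE andbN.
Qed.

(** Summing (a p - a q) * (a p ^ k - a q ^ k) >= 0 over all pairs (p, q); the
    proof keeps the products on the side where they are positive, so as to stay
    in nat. *)
Lemma chebyshev_sum (I : finType) (a : I -> nat) (k : nat) :
  (\sum_p a p) * (\sum_p a p ^ k) <= #|I| * \sum_p a p ^ k.+1.
Proof.
have h (x y : nat) : x * y ^ k + y * x ^ k <= x ^ k.+1 + y ^ k.+1.
  wlog xy : x y / x <= y.
    by move=> H; have [/H//|/ltnW/H] := leqP x y; rewrite addnC [X in _ <= X]addnC.
  have xyk : x ^ k <= y ^ k by case: k => // k; rewrite leq_exp2r.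
  rewrite !expnS; nia.
have E1 : (\sum_p a p) * (\sum_p a p ^ k) = \sum_p \sum_q a p * a q ^ k.
  by rewrite big_distrlr.
have E2 : (\sum_p a p) * (\sum_p a p ^ k) = \sum_p \sum_q a q * a p ^ k.
  by rewrite exchange_big big_distrlr.
have E3 : #|I| * (\sum_p a p ^ k.+1) = \sum_(p : I) \sum_q a q ^ k.+1.
  by rewrite sum_nat_const.
have E4 : #|I| * (\sum_p a p ^ k.+1) = \sum_p \sum_(q : I) a p ^ k.+1.
  by rewrite exchange_big sum_nat_const.
rewrite -(leq_pmul2l (isT : 0 < 2)) !mul2n -!addnn {1}E1 E2 {1}E4 E3.
rewrite -!big_split; apply: leq_sum => p _; rewrite -!big_split.
by apply: leq_sum => q _; exact: h.
Qed.

Lemma power_mean (I : finType) (a : I -> nat) (k : nat) :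
  (\sum_p a p) ^ k.+1 <= #|I| ^ k * \sum_p a p ^ k.+1.
Proof.
elim: k => [|k IHk]; first by rewrite expn1 mul1n.
rewrite expnS; apply: leq_trans (leq_mul (leqnn _) IHk) _.
rewrite mulnCA expnSr -mulnA leq_mul //; exact: chebyshev_sum.
Qed.

Definition cons_point (n m : nat) (a : 'I_m) (p : {ffun 'I_n -> 'I_m}) :
    {ffun 'I_n.+1 -> 'I_m} :=
  [ffun i => oapp p a (unlift ord0 i)].

Lemma cons_point_inj (n m : nat) :
  injective (fun q : 'I_m * {ffun 'I_n -> 'I_m} => cons_point q.1 q.2).
Proof.
move=> [a p] [b q] /= /ffunP h; congr pair.
  by have := h ord0; rewrite !ffunE unlift_none.
by apply/ffunP=> i; have := h (lift ord0 i); rewrite !ffunE liftK.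
Qed.

Lemma cons_point_surj (n m : nat) (x : {ffun 'I_n.+1 -> 'I_m}) :
  x = cons_point (x ord0) [ffun i => x (lift ord0 i)].
Proof.
by apply/ffunP=> i; rewrite ffunE; case: unliftP => [j|] -> //=; rewrite ffunE.
Qed.

(** Counting step from dimension n to n + 1.  Summing deg p ^ l.+1 over p counts
    the pairs of a point p and an l.+1-tuple L of values that all extend p to a
    point of T.  An injective L has a link without box, since a box in the link
    together with the entries of L is a box of T; a non-injective L has a link
    of at most m ^ n points, but such L are few.  The power mean inequality
    compares the sum with #|T| ^ l.+1. *)
Lemma card_box_free_step (n m l kap : nat) (T : {set {ffun 'I_n.+1 -> 'I_m}}) :
  (forall U : {set {ffun 'I_n -> 'I_m}}, ~ has_box l.+1 U -> #|U| <= kap) ->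
  ~ has_box l.+1 T ->
  #|T| ^ l.+1 <= (m ^ n) ^ l * (kap * m ^ l.+1 + 'C(l.+1, 2) * m ^ l * m ^ n).
Proof.
move=> hU hT.
pose deg (p : {ffun 'I_n -> 'I_m}) := #|[set a | cons_point a p \in T]|.
pose link (L : {ffun 'I_l.+1 -> 'I_m}) :=
  [set p | [forall j, cons_point (L j) p \in T]].
have cT : #|T| = \sum_p deg p.
  rewrite -sum1_card.
  rewrite (reindex (fun q : 'I_m * {ffun 'I_n -> 'I_m} => cons_point q.1 q.2)) /=.
    rewrite big_mkcond /= -(pair_big predT predT
      (fun a p => if cons_point a p \in T then 1 else 0)) /= exchange_big.
    apply: eq_bigr => p _; rewrite -big_mkcond /deg -sum1_card.
    by apply: eq_bigl => a; rewrite inE.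
  exists (fun x : {ffun 'I_n.+1 -> 'I_m} =>
    (x ord0, [ffun i => x (lift ord0 i)])) => q _ /=.
    by apply: (@cons_point_inj n m); rewrite /= -cons_point_surj.
  by rewrite -cons_point_surj.
have cL : \sum_p deg p ^ l.+1 = \sum_L #|link L|.
  transitivity (\sum_p \sum_(L | p \in link L) 1).
    apply: eq_bigr => p _; rewrite -[in LHS](card_ord l.+1) -card_ffun_on sum1_card.
    apply: eq_card => L; rewrite [RHS]inE; apply/ffun_onP/forallP => h j.
      by have := h j; rewrite inE.
    by rewrite inE.
  rewrite (exchange_big_dep predT) //=.
  by apply: eq_bigr => L _; rewrite sum1_card.
rewrite cT; apply: leq_trans (power_mean _ _) _.
rewrite card_ffun !card_ord leq_mul // cL.
rewrite (bigID (fun L => injectiveb (L : {ffun _}))) /=.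
apply: leq_add.
  apply: (@leq_trans (\sum_(L : {ffun 'I_l.+1 -> 'I_m}) kap)); last first.
    by rewrite sum_nat_const card_ffun !card_ord mulnC.
  rewrite [X in X <= _]big_mkcond; apply: leq_sum => L _.
  case: ifP => // /injectiveP Linj.
  apply: hU => -[g [ginj gL]]; apply: hT.
  exists (fun i => oapp g L (unlift ord0 i)); split.
    by move=> i; case: (unliftP ord0 i) => [j|] _ /=.
  move=> y.
  have := gL [ffun i => y (lift ord0 i)]; rewrite inE => /forallP/(_ (y ord0)).
  congr (_ \in T); apply/ffunP => i; rewrite !ffunE.
  by case: unliftP => [j|] -> //=; rewrite !ffunE.
pose noninj := [set L : {ffun 'I_l.+1 -> 'I_m} | ~~ injectiveb L].
apply: (@leq_trans (\sum_(L in noninj) m ^ n)).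
  rewrite [X in _ <= X](eq_bigl (fun L : {ffun _} => ~~ injectiveb L)); last first.
    by move=> L; rewrite inE.
  apply: leq_sum => L _; apply: leq_trans (max_card _) _.
  by rewrite card_ffun !card_ord.
by rewrite sum_nat_const leq_mul // card_noninjective_ffun.
Qed.

(** In dimension 1, l.+1 points already form a box. *)
Lemma card_box_free_line (m l : nat) (T : {set {ffun 'I_1 -> 'I_m}}) :
  ~ has_box l.+1 T -> #|T| <= l.
Proof.
move=> hT; rewrite leqNgt; apply/negP => lT; apply: hT.
have val_inj1 : injective (fun x : {ffun 'I_1 -> 'I_m} => x ord0).
  by move=> x y xy; apply/ffunP => i; rewrite ord1.
exists (fun _ j => (enum_val (widen_ord lT j) : {ffun 'I_1 -> 'I_m}) ord0); split.
  move=> _ i j /val_inj1/enum_val_inj/(congr1 val)/= ij; exact: val_inj.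
move=> y; have := enum_valP (widen_ord lT (y ord0)); congr (_ \in T).
by apply/ffunP => i; rewrite ffunE ord1.
Qed.

End GridBoxes.

Section Erdos.
Local Open Scope ring_scope.

(** Dimension n + 1 and side l + 1, with exponent n + 1 - 1 / (l + 1) ^ n. *)
Definition box_free_le (R : realType) (n m l K : nat) : Prop :=
  forall T : {set {ffun 'I_n.+1 -> 'I_m}}, ~ has_box l.+1 T ->
  (#|T|%:R : R) <= K%:R * m%:R `^ (n.+1%:R - (l.+1%:R ^+ n)^-1).

(** With del the new exponent defect, the old one is (l + 1) * del <= 1, so the
    contribution of the non-injective tuples is absorbed by the main term.  Both
    terms together have coefficient K + 'C(l + 1, 2) <= 2 ^ (l + 1), whose
    (l + 1)-th root is at most 2. *)
Lemma box_free_leS (R : realType) (n m l K : nat) :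
  (0 < m)%N -> (K + 'C(l.+1, 2) <= 2 ^ l.+1)%N ->
  box_free_le R n m l K -> box_free_le R n.+1 m l 2.
Proof.
move=> m0 hK h T hT.
set M : R := m%:R; set del : R := (l.+1%:R ^+ n.+1)^-1.
set r := K%:R * M `^ (n.+1%:R - (l.+1%:R ^+ n)^-1).
have M1 : 1 <= M by rewrite ler1n.
have M0 : 0 < M by exact: lt_le_trans M1.
have MD a b : M `^ (a + b) = M `^ a * M `^ b.
  by rewrite powRD // (gt_eqF M0) implybT.
have r0 : 0 <= r by rewrite mulr_ge0 // powR_ge0.
have hU (U : {set {ffun 'I_n.+1 -> 'I_m}}) :
    ~ has_box l.+1 U -> (#|U| <= Num.truncn r)%N.
  by move=> /h; rewrite truncn_ge_nat.
have := card_box_free_step hU hT.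
rewrite -(ler_nat R) natrX natrM -natrX natrD !natrM !natrX -/M => hx.
have kr : (Num.truncn r)%:R <= r by rewrite truncn_le.
have dl : (l.+1%:R ^+ n)^-1 = l.+1%:R * del.
  by rewrite /del exprS invfM mulrA divff ?mul1r.
have dl1 : l.+1%:R * del <= 1.
  by rewrite -dl invf_le1 ?exprn_gt0 // exprn_ege1 // ler1n.
rewrite -(@ler_pXn2r R l.+1) // ?nnegrE ?mulr_ge0 ?powR_ge0 //.
apply: le_trans hx _.
rewrite exprMn -[X in _ <= _ * X]powR_mulrn ?powR_ge0 // -powRrM.
have -> : (n.+2%:R - del) * l.+1%:R =
  (n.+1 * l)%N%:R + (l.+1%:R + (n.+1%:R - l.+1%:R * del)) :> R.
  by rewrite natrM -!natr1; ring.
rewrite MD powR_mulrn ?(ltW M0) // -exprM mulrCA; apply: ler_wpM2l.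
  by rewrite exprn_ge0 // ltW.
set W := M `^ _.
have W0 : 0 <= W by exact: powR_ge0.
have h1 : (Num.truncn r)%:R * M ^+ l.+1 <= K%:R * W.
  rewrite /W MD powR_mulrn ?(ltW M0) // [X in _ <= _ * X]mulrC mulrA ler_wpM2r //.
    by rewrite exprn_ge0 // ltW.
  by apply: le_trans kr _; rewrite /r dl.
have h2 : M ^+ l * M ^+ n.+1 <= W.
  rewrite -exprD -powR_mulrn ?(ltW M0) // ler_powR // natrD -!natr1.
  by move: dl1; rewrite -natr1; lra.
rewrite -(natrX R 2) -mulrA; apply: le_trans (lerD h1 (ler_wpM2l _ h2)) _ => //.
by rewrite -mulrDl ler_wpM2r // -natrD ler_nat.
Qed.

(** Starting from K = l in dimension 1, the numerical condition of the step
    holds for K = l, and then for K = 2 in all later steps.  For l >= 1 this is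
    because 1 + (l + 1) + 'C(l + 1, 2) is a partial sum of the binomial expansion
    of 2 ^ (l + 1); for l = 0 the condition is 2 <= 2. *)
Lemma box_free_le2 (R : realType) (n m l : nat) :
  (0 < m)%N -> (0 < n)%N -> box_free_le R n m l 2.
Proof.
move=> m0; have bin2 k : (2 + k + 'C(k.+1, 2) <= 2 ^ k.+1 + 1)%N.
  elim: k => [|k IHk] //.
  rewrite expnS binS bin1; have : (k.+1 < 2 ^ k.+1)%N by exact: ltn_expl.
  lia.
elim: n => // -[|n] IHn _; last first.
  apply: (box_free_leS m0 _ (IHn isT)).
  by case: l {IHn} => // l; have := bin2 l.+1; lia.
apply: (@box_free_leS _ _ _ _ l m0); first by have := bin2 l; lia.
move=> T /card_box_free_line hT; rewrite expr0 invr1 subrr powRr0 mulr1.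
by rewrite ler_nat.
Qed.

End Erdos.

(** * Zarankiewicz numbers in terms of grids *)

Section ZarankiewiczGrid.
Import fintype boot.finset.
Local Open Scope nat_scope.

Definition edge {n m : nat} (x : {ffun 'I_n -> 'I_m}) : {set vertex n m} :=
  [set v | x v.1 == v.2].

Lemma edge_inj (n m : nat) : injective (@edge n m).
Proof.
move=> x y /setP xy; apply/ffunP => i; have := xy (i, x i).
by rewrite !inE eqxx => /esym/eqP.
Qed.

Lemma transversalP (n m : nat) (e : {set vertex n m}) :
  reflect (exists x, e = edge x) (Defs.transversal e).
Proof.
apply: (iffP forallP) => [h|[x ->] i].
  have /fin_all_exists[x hx] i : exists a : 'I_m, e :&: part m i = [set (i, a)].
    have /cards1P[[j a] eij] := h i; exists a.
    have : (j, a) \in e :&: part m i by rewrite eij set11.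
    by rewrite !inE => /andP[_ /eqP/= ji]; rewrite eij ji.
  exists [ffun i => x i]; apply/setP => -[i a]; rewrite inE ffunE /=.
  have /setP/(_ (i, a)) := hx i; rewrite !inE /= eqxx andbT => ->.
  by rewrite -pair_eqE /= eqxx eq_sym.
rewrite (_ : _ :&: _ = [set (i, x i)]) ?cards1 //.
apply/setP => -[j a]; rewrite !inE /= -pair_eqE /=.
by apply/andP/andP => -[/eqP <- /eqP ->]; rewrite !eqxx.
Qed.

(** Two vertices in different parts of the complete hypergraph lie in a common
    edge, so a copy sends them to different parts.  As there are n parts on both
    sides, the copy induces a permutation s of the parts, and reindexing by its
    inverse t turns the copy into a box. *)
Lemma contains_complete_partiteP (n m l : nat) (T : {set {ffun 'I_n -> 'I_m}}) :
  reflect (has_box l.+1 T)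
          (contains_hg (edge @: T) (complete_partite n l.+1)).
Proof.
apply: (iffP existsP) => [[f /andP[/injectiveP finj /forallP hf]]|[g [ginj gT]]].
  have fT (y : {ffun 'I_n -> 'I_l.+1}) :
      exists2 x, x \in T & forall i, x (f (i, y i)).1 = (f (i, y i)).2.
    have := hf (edge y); rewrite inE => /implyP.
    have -> : Defs.transversal (edge y) by apply/transversalP; exists y.
    move=> /(_ isT)/imsetP[x xT fyx]; exists x => // i; apply/eqP.
    have : f (i, y i) \in edge x by rewrite -fyx imset_f // inE.
    by rewrite inE.
  have diff i j a b : i != j -> (f (i, a)).1 != (f (j, b)).1.
    move=> ij; apply/eqP => fij.
    have [x _ hx] := fT [ffun k => if k == i then a else b].
    have := hx i; rewrite ffunE eqxx fij => xi.
    have := hx j; rewrite ffunE eq_sym (negbTE ij) xi => eij.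
    suff /finj[] : f (i, a) = f (j, b) by move: ij => /eqP.
    by rewrite [LHS]surjective_pairing [RHS]surjective_pairing fij eij.
  (* The part to which the i-th part is sent. *)
  pose s i := (f (i, ord0)).1.
  have s_inj : injective s.
    by move=> i j sij; apply/eqP/negPn/negP => /(diff _ _ ord0 ord0)/eqP.
  have fs i a : (f (i, a)).1 = s i.
    have [t _ st] := injF_bij s_inj.
    apply/eqP; rewrite -[_.1]st; set j := t _.
    case: (eqVneq i j) => [<- //|/(diff _ _ a ord0)/eqP].
    by rewrite -/(s j) /j st.
  have [t ts st] := injF_bij s_inj.
  exists (fun j a => (f (t j, a)).2); split.
    move=> j a b ab; suff /finj[] : f (t j, a) = f (t j, b) by [].
    by rewrite [LHS]surjective_pairing [RHS]surjective_pairing !fs ab.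
  move=> y; have [x xT hx] := fT [ffun i => y (s i)].
  congr (_ \in T): xT; apply/ffunP => j; rewrite ffunE.
  by have := hx (t j); rewrite fs ffunE st.
exists [ffun w => (w.1, g w.1 w.2)]; apply/andP; split.
  by apply/injectiveP => -[i a] [j b]; rewrite !ffunE => -[<-] /= /ginj <-.
apply/forallP => e; apply/implyP; rewrite inE => /transversalP[y ->].
apply/imsetP; exists [ffun i => g i (y i)] => //.
apply/setP => -[i a]; rewrite [RHS]inE ffunE /=; apply/imsetP/eqP.
  by move=> [[j b]]; rewrite inE ffunE /= => /eqP <- [-> ->].
by move=> <-; exists (i, y i); rewrite ?inE ?ffunE.
Qed.

Lemma zarankiewicz_box (n m l : nat) (T : {set {ffun 'I_n -> 'I_m}}) :
  zarankiewicz n m l.+1 <= #|T| -> has_box l.+1 T.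
Proof.
rewrite /zarankiewicz; case: ex_minnP => z /forallP/(_ (edge @: T)) h _ zT.
apply/contains_complete_partiteP; apply: (implyP h).
rewrite card_imset ?zT ?andbT; last exact: edge_inj.
by apply/forallP => e; apply/implyP => /imsetP[x _ ->]; apply/transversalP; exists x.
Qed.

(** Stated with #|T|.+1 rather than a predecessor, so that the case of a
    vanishing Zarankiewicz number needs no exclusion. *)
Lemma zarankiewicz_box_free (n m l : nat) :
  exists2 T : {set {ffun 'I_n -> 'I_m}},
    zarankiewicz n m l.+1 <= #|T|.+1 & ~ has_box l.+1 T.
Proof.
rewrite /zarankiewicz; case: ex_minnP => -[|z] _ zmin.
  by exists set0 => // -[g [_ /(_ [ffun=> ord0])]]; rewrite inE.
have /forallPn[G] : ~~ zarankiewicz_bound n m l.+1 z.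
  by apply/negP => /zmin; rewrite ltnn.
rewrite negb_imply => /andP[/andP[/forallP Gp zG] GK].
have GE : edge @: (edge @^-1: G) = G.
  apply/setP => e; apply/imsetP/idP => [[x]|eG]; first by rewrite inE => ? ->.
  have /implyP/(_ eG)/transversalP[x ex] := Gp e.
  by exists x; rewrite // inE -ex.
exists (edge @^-1: G).
  by rewrite ltnS -(card_imset _ (@edge_inj n m)) GE.
by move/contains_complete_partiteP; rewrite GE; apply/negP.
Qed.

End ZarankiewiczGrid.

(** * Boxes in a product of types *)

Section TypedBoxes.
Local Open Scope classical_set_scope.
Local Open Scope card_scope.

Lemma card_eq_finset (T : finType) (F : {set T}) : [set` F] #= `I_#|F|.
Proof.
have inj : {in [set` F] &, injective (fun x => index x (enum F))}.
  move=> x y; rewrite !inE /= => xF yF /(congr1 (nth x (enum F))).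
  by rewrite !nth_index ?mem_enum.
apply/card_esym; apply: card_eq_trans (inj_card_eq inj).
rewrite (_ : [set _ | _ in _] = `I_#|F|) // eqEsubset; split=> k.
  by move=> [x /= xF <-]; rewrite cardE index_mem mem_enum.
rewrite /= cardE => kF; have [x _] : exists x, x \in F.
  by case: (enum F) kF (mem_enum F) => // x s _ /(_ x); rewrite mem_head; exists x.
exists (nth x (enum F) k); first by rewrite /= -mem_enum mem_nth.
by rewrite index_uniq ?enum_uniq.
Qed.

Lemma card_eq_ord (m : nat) : [set: 'I_m] #= `I_m.
Proof.
have := card_eq_finset [set: 'I_m]%SET; rewrite cardsT card_ord.
by rewrite (_ : [set` _] = setT) // -subTset => i _ /=; rewrite inE.
Qed.

Context {n : nat} {X : 'I_n -> Type}.
Implicit Types (C : set (set (forall i, X i))) (A : set (forall i, X i)).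

Definition grid m (b : forall i, 'I_m -> X i) (x : {ffun 'I_n -> 'I_m}) :
  forall i, X i := fun i => b i (x i).

Lemma grid_inj m (b : forall i, 'I_m -> X i) :
  (forall i, injective (b i)) -> injective (grid b).
Proof.
move=> binj x y /(congr1 (fun z : forall i, X i => z _)) xy.
by apply/ffunP => i; apply: (binj i); have := xy i.
Qed.

Lemma is_boxP m A :
  is_box m A <->
  exists2 b : forall i, 'I_m -> X i, forall i, injective (b i) & A = range (grid b).
Proof.
split=> [[B [Bm ->]]|[b binj ->]].
  have /fin_all_exists2[b binj brange] i :
      exists2 f : 'I_m -> X i, injective f & range f = B i.
    have : [set: 'I_m] #= B i.
      by apply: card_eq_trans (card_eq_ord m) _; exact/card_esym.
    move=> /card_bijP[f [f' ff' f'f]].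
    exists (fun a => val (f (SigSub (mem_set (I : [set: 'I_m] a))))).
      by move=> a a' /val_inj/(can_inj ff')/(congr1 val).
    rewrite eqEsubset; split=> x.
      by move=> [a _ <-]; exact: set_valP.
    move=> Bx; exists (val (f' (SigSub (mem_set Bx)))) => //.
    rewrite (_ : SigSub _ = f' (SigSub (mem_set Bx))) ?f'f //; exact: val_inj.
  exists b => //; rewrite eqEsubset; split=> x /=.
    move=> Bx; have /fin_all_exists[y yx] i : exists a, b i a = x i.
      by have := Bx i; rewrite -brange => -[a _ <-]; exists a.
    by exists [ffun i => y i] => //; apply: functional_extensionality_dep => i;
      rewrite /grid ffunE.
  by move=> [y _ <-] i; rewrite -brange; exists (y i).
exists (fun i => range (b i)); split.
  move=> i; apply: card_eq_trans (card_eq_ord m).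
  by apply: inj_card_eq; apply: in2W; exact: binj.
rewrite eqEsubset; split=> [_ [y _ <-] i|x bx /=]; first by exists (y i).
have /fin_all_exists[y yx] i : exists a, b i a = x i by have [a _] := bx i; exists a.
by exists [ffun i => y i] => //; apply: functional_extensionality_dep => i;
  rewrite /grid ffunE.
Qed.

(** The trace of C on the box with coordinates b, transported to the finite
    index grid. *)
Definition grid_trace C m (b : forall i, 'I_m -> X i) :
    {set {set {ffun 'I_n -> 'I_m}}} :=
  [set T : {set {ffun 'I_n -> 'I_m}} |
    `[< exists2 S, C S & forall x, (x \in T) = `[< S (grid b x) >] >]]%SET.

Lemma trace_grid C m (b : forall i, 'I_m -> X i) :
  (forall i, injective (b i)) ->
  trace C (range (grid b)) #= `I_#|grid_trace C b|.
Proof.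
move=> binj; apply: card_eq_trans (card_eq_finset _).
have inj : {in [set` grid_trace C b] &,
    injective (fun T : {set {ffun 'I_n -> 'I_m}} => grid b @` [set` T])}.
  move=> T T' _ _ TT'; apply/setP => x; apply/idP/idP => xT.
    have : (grid b @` [set` T]) (grid b x) by exists x.
    by rewrite TT' => -[y /= yT' /(grid_inj binj) <-].
  have : (grid b @` [set` T']) (grid b x) by exists x.
  by rewrite -TT' => -[y /= yT' /(grid_inj binj) <-].
apply: card_eq_trans (inj_card_eq inj).
rewrite (_ : trace _ _ = [set grid b @` [set` T] | T in [set` grid_trace C b]]) //.
rewrite eqEsubset; split=> [_ [S CS <-]|_ [T + <-]].
  exists [set x | `[< S (grid b x) >]]%SET.
    by rewrite /= inE; apply/asboolP; exists S => // x; rewrite inE.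
  rewrite eqEsubset; split=> [_ [x + <-]|z [+ [x _ xE]]] /=.
    by rewrite /= inE => /asboolP Sx; split=> //; exists x.
  by rewrite -xE => Sx; exists x => //=; rewrite inE; apply/asboolP.
rewrite /= inE => /asboolP[S CS TS]; exists S => //.
rewrite eqEsubset; split=> [z [+ [x _ xE]]|_ [x + <-]].
  by rewrite -xE => Sx; exists x => //=; rewrite TS; apply/asboolP.
by rewrite /= TS => /asboolP Sx; split=> //; exists x.
Qed.

(** A class that shatters a set of points also shatters its subsets; here the
    subset is a box. *)
Lemma shatters_subgrid C m l (b : forall i, 'I_m -> X i)
    (S : {set {ffun 'I_n -> 'I_m}}) :
  (forall i, injective (b i)) -> has_box l S ->
  S \in shattered_sets (grid_trace C b) ->
  exists2 A, is_box l A & shatters C A.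
Proof.
move=> binj [g [ginj gS]] Ssh; exists (range (grid (fun i a => b i (g i a)))).
  apply/is_boxP; exists (fun i a => b i (g i a)) => // i a a' /binj; exact: ginj.
have gridE y : grid (fun i a => b i (g i a)) y = grid b [ffun i => g i (y i)].
  by apply: functional_extensionality_dep => i; rewrite /grid ffunE.
rewrite /shatters eqEsubset; split=> [_ [E _ <-] x []//|U /= UA].
pose U' := [set x in S | `[< U (grid b x) >]]%SET.
have [|T] := shattered_setsP _ _ Ssh U'.
  by apply/fintype.subsetP => x; rewrite inE => /andP[].
rewrite inE => /asboolP[E CE TE] U'E; exists E => //.
rewrite eqEsubset; split=> [z [+ [y _ yE]]|z Uz].
  rewrite -yE gridE => Ey; have /setP/(_ [ffun i => g i (y i)]) := U'E.
  by rewrite !inE gS TE /= (asboolT Ey) => /asboolP.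
have [y _ yz] := UA z Uz; split; last by exists y.
have /setP/(_ [ffun i => g i (y i)]) := U'E.
by rewrite !inE gS TE /= -gridE yz (asboolT Uz) => /esym/asboolP.
Qed.

Lemma leq_shatter_fun C m N :
  (forall A k, is_box m A -> trace C A #= `I_k -> (k <= N)%N) ->
  (shatter_fun C m <= N)%N.
Proof.
move=> h; rewrite /shatter_fun /supremum; case: ifPn => // /set0P[k kA].
case: xgetP => [s _ [_ /(_ N)]|] //; apply=> k' [A]; exact: h.
Qed.

Lemma shatter_fun_geq C m A k :
  is_box m A -> trace C A #= `I_k -> (k <= shatter_fun C m)%N.
Proof.
move=> Am Ak; rewrite /shatter_fun; set K := [set _ | _].
have Kk : K k by exists A.
pose N := #|{set {ffun 'I_n -> 'I_m}}|.
have KN j : K j -> (j <= N)%N.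
  move=> [_ /is_boxP[b binj ->]] /card_esym Bj.
  have /card_eq_II -> := card_eq_trans Bj (trace_grid C binj); exact: max_card.
have exK : exists j, `[< K j >] by exists k; apply/asboolP.
have [s /asboolP Ks smax] := ex_maxnP exK (fun j Kj => KN j (asboolW Kj)).
have sK : supremums K s.
  split=> [j Kj|j]; first by apply: smax; apply/asboolP.
  by apply.
rewrite /supremum; case: ifPn => [/eqP K0|_]; first by rewrite K0 in Kk.
case: xgetP => [t _ [+ _]|/(_ s)//]; exact.
Qed.

Lemma leq_VCdim (R : realType) C m A :
  is_box m A -> shatters C A -> (m%:R%:E <= VCdim R C)%E.
Proof.
by move=> Am CA; apply: ereal_sup_ubound; exists m => //; exists A.
Qed.

Lemma shatter_fun_zarankiewicz (R : realType) C d m :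
  (VCdim R C <= d%:R%:E)%E ->
  (shatter_fun C m <= \sum_(i < zarankiewicz n m d.+1) 'C(m ^ n, i))%N.
Proof.
move=> Cd; apply: leq_shatter_fun => A k /is_boxP[b binj ->] /card_esym trk.
have /card_eq_II -> := card_eq_trans trk (trace_grid C binj).
have -> : (m ^ n = #|{ffun 'I_n -> 'I_m}|)%N by rewrite card_ffun !card_ord.
apply: sauer_shelah => S Ssh; rewrite ltnNge; apply/negP => /zarankiewicz_box Sbox.
have [B Bd CB] := shatters_subgrid binj Sbox Ssh.
have := le_trans (leq_VCdim R Bd CB) Cd.
by rewrite lee_fin ler_nat ltnn.
Qed.

Lemma box_exists m : (forall i, infinite_set [set: X i]) -> exists A, is_box m A.
Proof.
move=> Xinf.
have /fin_all_exists[b binj] i : exists f : 'I_m -> X i, injective f.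
  have /card_leP[f] : [set: nat] #<= [set: X i] by apply/infiniteP.
  exists (fun a => val (f (SigSub (mem_set (I : [set: nat] a))))).
  move=> a a' /val_inj/(inj (mem_set I) (mem_set I))/(congr1 val) /=.
  exact: val_inj.
by exists (range (grid b)); apply/is_boxP; exists b.
Qed.

(** The extremal class: being closed under subsets, it shatters exactly the
    boxes that belong to it. *)
Definition box_free_class (l : nat) : set (set (forall i, X i)) :=
  [set S | ~ exists2 A, is_box l A & A `<=` S].

Lemma sub_box l m A : (l <= m)%N -> is_box m A -> exists2 B, is_box l B & B `<=` A.
Proof.
move=> lm /is_boxP[b binj ->].
exists (range (grid (fun i a => b i (widen_ord lm a)))).
  apply/is_boxP; exists (fun i a => b i (widen_ord lm a)) => // i a a' /binj.
  by move=> /(congr1 val)/= aa'; exact: val_inj.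
move=> _ [y _ <-]; exists [ffun i => widen_ord lm (y i)] => //.
by apply: functional_extensionality_dep => i; rewrite /grid ffunE.
Qed.

(** Constant index points suffice to compare the sides in one direction, which
    exists because n > 0. *)
Lemma sub_box_leq l m A B :
  (0 < n)%N -> is_box l A -> is_box m B -> A `<=` B -> (l <= m)%N.
Proof.
move=> n0 /is_boxP[b binj ->] /is_boxP[c cinj ->] bc.
pose i0 := Ordinal n0.
have /fin_all_exists[h hb] a : exists a', c i0 a' = b i0 a.
  have [|y _ /(congr1 (fun z : forall i, X i => z i0)) yb] := bc (grid b [ffun=> a]).
    by exists [ffun=> a].
  by exists (y i0); move: yb; rewrite /grid ffunE.
rewrite -(card_ord l) -(card_ord m); apply: (leq_card h) => a a' haa'.
by apply: (binj i0); rewrite -!hb haa'.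
Qed.

Lemma has_box_grid l m (b : forall i, 'I_m -> X i)
    (T : {set {ffun 'I_n -> 'I_m}}) A :
  (forall i, injective (b i)) -> is_box l A -> A `<=` grid b @` [set` T] ->
  has_box l T.
Proof.
move=> binj /is_boxP[c cinj ->] cT.
have /fin_all_exists[g gc] i :
    exists gi : 'I_l -> 'I_m, forall a, b i (gi a) = c i a.
  apply: (@fin_all_exists _ (fun=> 'I_m) (fun a a' => b i a' = c i a)) => a.
  have [|x _ /(congr1 (fun z : forall i, X i => z i)) xa] := cT (grid c [ffun=> a]).
    by exists [ffun=> a].
  by exists (x i); move: xa; rewrite /grid ffunE.
exists g; split=> [i a a' gaa'|y]; first by apply: (cinj i); rewrite -!gc gaa'.
have [|x xT xy] := cT (grid c y); first by exists y.
rewrite (_ : [ffun _ => _] = x) //; apply: (grid_inj binj); rewrite xy.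
by apply: functional_extensionality_dep => i; rewrite /grid ffunE gc.
Qed.

Lemma VCdim_box_free_class (R : realType) d :
  (0 < n)%N -> (forall i, infinite_set [set: X i]) ->
  VCdim R (box_free_class d.+1) = d%:R%:E.
Proof.
move=> n0 Xinf; apply/eqP; rewrite eq_le; apply/andP; split.
  apply: ub_ereal_sup => _ [m [A Am shA] <-]; rewrite lee_fin ler_nat leqNgt.
  apply/negP => dm; have [B Bd BA] := sub_box dm Am.
  have [S] : trace (box_free_class d.+1) A A by rewrite shA.
  by move=> Sfree SA; apply: Sfree; exists B => //; rewrite -SA in BA => x /BA[].
have [A Ad] := box_exists d Xinf.
apply: (leq_VCdim R Ad); rewrite /shatters eqEsubset.
split=> [_ [S _ <-] x []//|U /= UA]; exists U; last exact/setIidPl.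
move=> [B Bd /subset_trans/(_ UA)/(sub_box_leq n0 Bd Ad)].
by rewrite ltnn.
Qed.

Lemma shatter_fun_box_free_class d m :
  (forall i, infinite_set [set: X i]) ->
  (2 ^ (zarankiewicz n m d.+1 - 1) <= shatter_fun (box_free_class d.+1) m)%N.
Proof.
move=> Xinf; have [A Am] := box_exists m Xinf.
have /is_boxP[b binj AE] := Am; rewrite {}AE in Am.
have [T zT Tfree] := zarankiewicz_box_free n m d.
apply: leq_trans (shatter_fun_geq Am (trace_grid _ binj)).
apply: (@leq_trans (2 ^ #|T|)); first by rewrite leq_exp2l // leq_subLR.
rewrite -card_powerset; apply/subset_leq_card/fintype.subsetP => U.
rewrite powersetE inE => UT; apply/asboolP; exists (grid b @` [set` U]).
  move=> [B Bd BU]; apply/Tfree/(has_box_grid binj Bd)/(subset_trans BU).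
  by move=> _ [x /= xU <-]; exists x => //=; exact: (fintype.subsetP UT).
move=> x; apply/idP/asboolP => [xU|[y /= yU /(grid_inj binj) <- //]].
by exists x.
Qed.

End TypedBoxes.

(** * Growth rates *)

Section Asymptotics.
Local Open Scope ring_scope.
Context {R : realType}.

Lemma powR2_log2 (x : R) : 0 < x -> 2 `^ log2 x = x.
Proof.
move=> x0; have ln2 : ln (2 : R) != 0 by rewrite gt_eqF // ln_gt0 // ltr1n.
by rewrite /powR pnatr_eq0 /= /log2 divfK // lnK.
Qed.

Lemma log2_nat_ge0 (m : nat) : 0 <= log2 (m%:R : R).
Proof.
case: m => [|m]; first by rewrite /log2 ln0 // mul0r.
by rewrite divr_ge0 // ln_ge0 // ler1n.
Qed.

(** ln x < x applied to x = m ^ (del / 2) bounds log2 m by a constant times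
    m ^ (del / 2); the other factor m ^ (del / 2) eventually exceeds the
    constant. *)
Lemma log2_little_powR (K del : R) : 0 <= K -> 0 < del ->
  exists m0, forall m, (m0 <= m)%N -> K * log2 m%:R <= m%:R `^ del.
Proof.
move=> K0 del0; pose L := K * (2 / del) / ln 2.
have ln2 : 0 < ln (2 : R) by rewrite ln_gt0 // ltr1n.
have L0 : 0 <= L by rewrite !mulr_ge0 ?invr_ge0 ?(ltW ln2) ?(ltW del0).
exists (Num.truncn (L `^ (2 / del))).+1 => m hm.
have m0 : 0 < m%:R :> R by rewrite ltr0n (leq_trans _ hm).
have Lm : L <= m%:R `^ (del / 2).
  have -> : L = (L `^ (2 / del)) `^ (del / 2).
    by rewrite -powRrM (_ : _ * _ = 1) ?powRr1 //; field; rewrite gt_eqF.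
  apply: ge0_ler_powR; rewrite ?nnegrE ?powR_ge0 ?(ltW m0) //.
    by rewrite divr_ge0 // ltW.
  have /andP[_ /ltW] := truncn_itv (powR_ge0 L (2 / del)).
  by move=> /le_trans; apply; rewrite ler_nat.
have lnm : ln m%:R <= 2 / del * m%:R `^ (del / 2).
  have /ltW := ln_sublinear (powR_gt0 (del / 2) m0); rewrite ln_powR => h.
  rewrite -ler_pdivrMl ?divr_gt0 // invf_div; exact: h.
apply: (@le_trans _ _ (L * m%:R `^ (del / 2))).
  rewrite (_ : L * _ = K * (2 / del * m%:R `^ (del / 2) / ln 2)); last first.
    by rewrite /L; ring.
  by apply: ler_wpM2l => //; rewrite /log2 ler_wpM2r // invr_ge0 ltW.
rewrite (_ : m%:R `^ del = m%:R `^ (del / 2) * m%:R `^ (del / 2)).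
  by apply: ler_wpM2r => //; exact: powR_ge0.
by rewrite -powRD ?(gt_eqF m0) ?implybT // -splitr.
Qed.

Lemma sum_bin_leq_exp (N z : nat) :
  (1 < N)%N -> (\sum_(i < z) 'C(N, i) <= N ^ z)%N.
Proof.
move=> N1; elim: z => [|z IHz]; first by rewrite big_ord0.
have binN : ('C(N, z) <= N ^ z)%N.
  apply: (@leq_trans (N ^_ z)).
    by rewrite -bin_ffact leq_pmulr // fact_gt0.
  by elim: z {IHz} => // z IHz; rewrite ffactnSr expnSr leq_mul // leq_subr.
rewrite big_ord_recr /= expnS; apply: leq_trans (leq_add IHz binN) _.
by rewrite addnn -mul2n leq_mul2r N1 orbT.
Qed.

Lemma sum_bin_le_powR (m n z : nat) (x : R) :
  (1 < m)%N -> (0 < n)%N -> n%:R * z%:R <= x ->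
  (\sum_(i < z) 'C(m ^ n, i))%:R <= 2 `^ (x * log2 m%:R).
Proof.
move=> m1 n0 zx; have m0 : 0 < m%:R :> R by rewrite ltr0n ltnW.
rewrite mulrC powRrM powR2_log2 //.
apply: (@le_trans _ _ ((m ^ n) ^ z)%:R).
  by rewrite ler_nat sum_bin_leq_exp // -(exp1n n) ltn_exp2r.
rewrite -expnM natrX -powR_mulrn ?(ltW m0) //.
by apply: ler_powR; rewrite ?ler1n ?(ltnW m1) // natrM.
Qed.

Lemma zarankiewicz1 (n m : nat) : (zarankiewicz n m 1 <= 1)%N.
Proof.
have [T zT Tfree] := zarankiewicz_box_free n m 0.
apply: leq_trans zT _; rewrite ltnS leqn0 cards_eq0.
apply/eqP/finset.setP => x; rewrite inE; apply/negP => xT; apply: Tfree.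
exists (fun i _ => x i); split=> [i a a'|y]; first by rewrite !ord1.
by rewrite (_ : [ffun _ => _] = x) //; apply/ffunP => i; rewrite ffunE.
Qed.

Lemma zarankiewicz_line (m d : nat) : (zarankiewicz 1 m d.+1 <= d.+1)%N.
Proof.
have [T zT /card_box_free_line Tfree] := zarankiewicz_box_free 1 m d.
by apply: leq_trans zT _; rewrite ltnS.
Qed.

(** The bound 2 * m ^ e on box-free sets, with e = n - eps, loses at most 1 when
    passing to the Zarankiewicz number.  Since d >= 1 gives eps <= 1 / 2, the
    exponent e is at least 3 / 2, so n ^ e >= 2 ^ (3 / 2) >= 5 / 2 leaves
    m ^ e / 2 >= 1 to spare. *)
Lemma zarankiewicz_upper (m n d : nat) :
  (1 < m)%N -> (1 < n)%N -> (0 < d)%N ->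
  let eps : R := 1 / (d%:R + 1) ^+ n.-1 in
  (zarankiewicz n m d.+1)%:R <= (n%:R * m%:R) `^ (n%:R - eps).
Proof.
case: n => // n m1 n1 d0 /=; set eps := 1 / _.
have [T zT Tfree] := zarankiewicz_box_free n.+1 m d.
have m0 : (0 < m)%N := ltnW m1.
have Tm : #|T|%:R <= 2 * m%:R `^ (n.+1%:R - eps).
  by rewrite /eps div1r natr1; exact: (box_free_le2 R m0 n1 Tfree).
have n2 : 2 <= n.+1%:R :> R by rewrite ler_nat.
have eps2 : eps <= 1 / 2.
  rewrite /eps !div1r lef_pV2 ?posrE ?exprn_gt0 // natr1.
  apply: (@le_trans _ _ d.+1%:R); first by rewrite ler_nat.
  by rewrite -[leLHS]expr1 ler_weXn2l // ler1n.
rewrite powRM //; move: Tm; set e := _ - eps => Tm.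
have e32 : 3 / 2 <= e by rewrite /e; lra.
have me : 2 <= m%:R `^ e.
  apply: (@le_trans _ _ m%:R); first by rewrite ler_nat.
  rewrite -[leLHS]powRr1 //; apply: ler_powR; first by rewrite ler1n.
  by lra.
have ne : 5 / 2 <= n.+1%:R `^ e.
  apply: (@le_trans _ _ (2 `^ (3 / 2))); last first.
    apply: (@le_trans _ _ (2 `^ e)).
      by apply: ler_powR => //; rewrite ler1n.
    by apply: ge0_ler_powR; rewrite ?nnegrE //; lra.
  have ge0 : 0 <= 5 / 2 :> R by rewrite divr_ge0.
  rewrite -(@ler_pXn2r R 2) ?nnegrE ?powR_ge0 //.
  rewrite -[X in _ <= X]powR_mulrn ?powR_ge0 // -powRrM.
  rewrite (_ : 3 / 2 * 2 = 3%:R); last by field.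
  by rewrite powR_mulrn // expr2 !exprS expr0; lra.
have : (zarankiewicz n.+1 m d.+1)%:R <= #|T|%:R + 1 :> R.
  by rewrite natr1 ler_nat.
nra.
Qed.

End Asymptotics.

Local Open Scope classical_set_scope.
Local Open Scope ring_scope.

(** The choice eps' = eps / 2 leaves a factor m ^ (eps / 2) to beat the
    logarithm.  The constant c + (d + 1) handles dimension 1 along with the
    others: there the shatter function is at most m ^ (d + 1) and eps = 1. *)
Lemma shatter_fun_asymptotics (R : realType) (n d : nat) : (0 < n)%N ->
  let eps : R := 1 / (d%:R + 1) ^+ n.-1 in
  let c : R := n%:R `^ (n%:R + 1 - eps) in
  exists2 eps' : R, 0 < eps' &
  exists m0 : nat,
  forall X : 'I_n -> Type,
  forall C : set (set (forall i, X i)), (VCdim R C <= d%:R%:E)%E ->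
  forall m : nat, (m0 <= m)%N ->
  let middle : R := 2 `^ (c * m%:R `^ (n%:R - eps) * log2 m%:R) in
  let right : R := 2 `^ (m%:R `^ (n%:R - eps')) in
  [/\ (n = 1%N -> d = 0%N) -> (shatter_fun C m)%:R <= middle,
      middle <= right
    & (shatter_fun C m)%:R <= right].
Proof.
move=> n0 eps c.
have eps0 : 0 < eps by rewrite divr_gt0 // exprn_gt0 // natr1.
have c0 : 0 <= c by exact: powR_ge0.
have [||m0 hm0] := @log2_little_powR R (c + d.+1%:R) (eps / 2).
- by rewrite addr_ge0.
- by rewrite divr_gt0.
exists (eps / 2); first by rewrite divr_gt0.
exists (maxn 2 m0) => X C Cd m; rewrite geq_max => /andP[m1 /hm0 {hm0}].
have lg0 := log2_nat_ge0 (R := R) m; have mR : 1 <= m%:R :> R by rewrite ler1n ltnW.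
have m_gt0 : 0 < m%:R :> R by exact: lt_le_trans mR.
set lg := log2 _ in lg0 *; set P := m%:R `^ (n%:R - eps).
have P0 : 0 <= P by exact: powR_ge0.
rewrite mulrDl => hm middle right.
have two1 : 1 <= 2 :> R by rewrite ler1n.
have rightE : right = 2 `^ (P * m%:R `^ (eps / 2)).
  rewrite /right /P -powRD; last by rewrite (gt_eqF m_gt0) implybT.
  by congr (2 `^ (_ `^ _)); rewrite [in LHS](splitr eps); field.
have mid_right : middle <= right.
  rewrite rightE; apply: ler_powR => //; rewrite mulrAC mulrC ler_wpM2l //.
  by apply: le_trans hm; rewrite lerDl; exact: mulr_ge0.
have shz : (shatter_fun C m)%:R <=
    (\sum_(i < zarankiewicz n m d.+1) 'C(m ^ n, i))%:R :> R.
  by rewrite ler_nat; exact: shatter_fun_zarankiewicz Cd.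
have sh_mid : (n = 1%N -> d = 0%N) -> (shatter_fun C m)%:R <= middle.
  move=> nd; case: (posnP d) => [d0|d_gt0].
    (* For d = 0 the Zarankiewicz number is at most 1 and the sum is at most 1. *)
    apply: (@le_trans _ _ 1).
      apply: le_trans shz _; rewrite lern1 d0.
      case: (zarankiewicz _ _ _) (zarankiewicz1 n m) => [|[|//]] _.
        by rewrite big_ord0.
      by rewrite big_ord1 bin0.
    rewrite -[leLHS](powRr0 2); apply: ler_powR => //.
    exact: mulr_ge0 (mulr_ge0 c0 P0) lg0.
  have n1 : (1 < n)%N.
    by case: (n) n0 nd => [|[|k]] // _ /(_ erefl) d0; rewrite d0 in d_gt0.
  apply: le_trans shz _; apply: sum_bin_le_powR => //.
  rewrite /c (_ : n%:R + 1 - eps = 1 + (n%:R - eps)); last by ring.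
  rewrite powRD; last by rewrite pnatr_eq0 -lt0n n0 implybT.
  rewrite powRr1 // -mulrA ler_wpM2l // -powRM //.
  exact: zarankiewicz_upper.
split=> //.
have [n1|n1] := eqVneq n 1%N; last first.
  by apply: le_trans mid_right; apply: sh_mid => n1'; rewrite n1' in n1.
apply: le_trans shz _; rewrite rightE.
apply: (@le_trans _ _ (2 `^ (d.+1%:R * lg))).
  apply: sum_bin_le_powR => //; rewrite {}n1 mul1r ler_nat.
  exact: zarankiewicz_line.
apply: ler_powR => //.
have -> : P = 1.
  by rewrite /P /eps n1 expr0 divr1 subrr powRr0.
rewrite mul1r; apply: le_trans hm.
by rewrite lerDr; exact: mulr_ge0.
Qed.

Theorem proposition3p9 (R : realType) (n d : nat) (n_gt0 : (1 <= n)%N) :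
  (* (1) *)
  (forall X : 'I_n -> Type, (forall i, infinite_set [set: X i]) ->
   forall C : set (set (forall i, X i)), (VCdim R C <= d%:R%:E)%E ->
   forall m : nat, (d <= m)%N ->
   (shatter_fun C m <= \sum_(i < zarankiewicz n m d.+1) 'C(m ^ n, i))%N)
  /\
  (* (2) *)
  (let eps : R := 1 / (d%:R + 1) ^+ n.-1 in
   let c : R := n%:R `^ (n%:R + 1 - eps) in
   exists2 eps' : R, 0 < eps' &
   exists m0 : nat,
   forall X : 'I_n -> Type, (forall i, infinite_set [set: X i]) ->
   forall C : set (set (forall i, X i)), (VCdim R C <= d%:R%:E)%E ->
   forall m : nat, (m0 <= m)%N ->
   let middle : R := 2 `^ (c * m%:R `^ (n%:R - eps) * log2 m%:R) in
   let right : R := 2 `^ (m%:R `^ (n%:R - eps')) in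
   [/\ (* for n = 1 and d >= 1 this first inequality fails *)
       (n = 1%N -> d = 0%N) -> (shatter_fun C m)%:R <= middle,
       middle <= right
     & (shatter_fun C m)%:R <= right])
  /\
  (* (3) *)
  (forall X : 'I_n -> Type, (forall i, infinite_set [set: X i]) ->
   exists2 C : set (set (forall i, X i)), VCdim R C = d%:R%:E &
   forall m : nat, (2 ^ (zarankiewicz n m d.+1 - 1) <= shatter_fun C m)%N).
Proof.
split; last split.
- by move=> X _ C Cd m _; exact: shatter_fun_zarankiewicz Cd.
- have [eps' eps'0 [m0 h]] := shatter_fun_asymptotics R d n_gt0.
  by exists eps' => //; exists m0 => X _; exact: h.
- move=> X Xinf; exists (box_free_class d.+1); first exact: VCdim_box_free_class.
  by move=> m; exact: shatter_fun_box_free_class.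
Qed.
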